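(* Let $\Lambda \subseteq \mathbb{C}_\infty$ be a discrete $\mathbb{F}_q$-vector space, let $e_\Lambda(z) = z \prod_{0 \neq \lambda \in \Lambda} (1 - z/\lambda)$ and $t = t_\Lambda(z) = 1/e_\Lambda(z)$. For $r \geqslant 0$ define $\beta_{r,j}$ by \[ G_{r+1,\Lambda}(t) = \sum_{j=0}^{r} \beta_{r,j}\, t^{j+1}. \] Then, for all $r \geqslant 0$: \[ \partial_z^r ( t^n ) = (-1)^r \cdot t^n\, \partial_t^{n-1} \bigl( t^{n-2} G_{r+1,\Lambda}(t) \bigr) \quad \text{for all } n \geqslant 1, \] \[ \partial_z^r (t^n) = (-1)^r \sum_{j=0}^r \beta_{r,j}\, t^{j+1}\, \partial_t^{j} (t^{n+j-1}) \quad \text{for all } n \geqslant 0, \] and \[ \binom{n+r-1}{r} G_{n+r,\Lambda}(t) = \sum_{j=0}^{r} \beta_{r,j}\, t^{j+1}\, \partial_t^{j} \bigl( t^{j-1} G_{n,\Lambda}(t) \bigr) \quad \text{for all } n \geqslant 1. \]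
   Context: $q$ is a power of a prime $p$, $\mathbb{F}_q$ the field with $q$ elements, $K_\infty = \mathbb{F}_q((1/\theta))$, and $\mathbb{C}_\infty$ is the completion of an algebraic closure of $K_\infty$. A discrete $\mathbb{F}_q$-vector space $\Lambda \subseteq \mathbb{C}_\infty$ is either finite-dimensional or a union of a nested sequence of finite-dimensional $\mathbb{F}_q$-subspaces with only finitely many elements in each bounded ball; then $e_\Lambda(z) = \sum_{j \geqslant 0} \alpha_j z^{q^j}$ is an $\mathbb{F}_q$-linear entire function. The Goss polynomials $G_{k,\Lambda}(t)$ ($k \geqslant 1$) are the polynomials in $t$ defined by the generating series $\sum_{k \geqslant 1} G_{k,\Lambda}(t) x^k = \frac{tx}{1 - t e_\Lambda(x)}$; equivalently $\sum_{\lambda \in \Lambda} (z-\lambda)^{-k} = G_{k,\Lambda}(t_\Lambda(z))$. Hyperderivatives: $\partial_t^j(t^n) = \binom{n}{j} t^{n-j}$ for $n \in \mathbb{Z}$ (with $\binom{n}{j} = n(n-1)\cdots(n-j+1)/j!$), extended linearly to Laurent polynomials; $\partial_z^j$ denotes the $j$-th hyperderivative in $z$ of (meromorphic) functions of $z$, characterized by the Taylor expansion $f(z) = \sum_{j \geqslant 0} \partial_z^j(f)(c)(z-c)^j$ at points $c$ of regularity. In the identities, polynomials in $t$ are evaluated at $t = t_\Lambda(z)$. *)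

(* Defs.v *)
From HB Require Import structures.
From mathcomp Require Import all_boot all_order all_algebra finmap.
From mathcomp Require Import all_classical all_reals all_analysis.
Set Implicit Arguments.
Unset Strict Implicit.
Unset Printing Implicit Defensive.
Import Order.TTheory GRing.Theory Num.Theory.
Import numFieldNormedType.Exports.
Local Open Scope classical_set_scope.
Local Open Scope ring_scope.

Definition vcvg (R : realType) (C : fieldType) (v : C -> R)
    (u : nat -> C) (l : C) : Prop :=
  (fun n => v (u n - l)) @ \oo --> (0 : R).

Definition vcauchy (R : realType) (C : fieldType) (v : C -> R)
    (u : nat -> C) : Prop :=
  forall eps : R, 0 < eps ->
    exists N : nat, forall m n, (N <= m)%N -> (N <= n)%N -> v (u m - u n) < eps.

Record nonarch_abs (R : realType) (C : fieldType) (v : C -> R) : Prop :=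
  NonarchAbs {
    nabs_ge0 : forall x, 0 <= v x;
    nabs_eq0 : forall x, v x = 0 <-> x = 0;
    nabsM : forall x y, v (x * y) = v x * v y;
    nabsD : forall x y, v (x + y) <= Num.max (v x) (v y) }.

(* F((1/theta)) as a subset of C: the values of the Laurent series
   sum_(i >= 0) a_i theta^(N - i), N an integer and a_i in F. *)
Definition Kinf (R : realType) (F : finFieldType) (C : fieldType)
    (iota : {rmorphism F -> C}) (theta : C) (v : C -> R) : set C :=
  [set x | exists (N : int) (a : nat -> F),
     vcvg v (fun n => \sum_(i < n) iota (a i) * theta ^ (N - i%:Z)) x].

Definition algebraic_over (C : fieldType) (K : set C) : set C :=
  [set x | exists p : {poly C}, [/\ p != 0, forall i, K p`_i & root p x]].

(* (C, v) is the completion of an algebraic closure of F((1/theta)), where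
   F = F_q is any finite field: inside C, the elements algebraic over
   F((1/theta)) form an algebraically closed field, which is dense in the
   complete C.  The normalisation of v is left free, up to |theta| > 1. *)
Record is_Cinf (R : realType) (F : finFieldType) (C : fieldType)
    (iota : {rmorphism F -> C}) (theta : C) (v : C -> R) : Prop := IsCinf {
  Cinf_abs : nonarch_abs v;
  Cinf_theta : 1 < v theta;
  Cinf_closure : forall p : {poly C}, (1 < size p)%N ->
    (forall i, algebraic_over (Kinf iota theta v) p`_i) ->
    exists2 x, algebraic_over (Kinf iota theta v) x & root p x;
  Cinf_dense : forall (x : C) (eps : R), 0 < eps ->
    exists2 y, algebraic_over (Kinf iota theta v) y & v (x - y) < eps;
  Cinf_complete : forall u : nat -> C, vcauchy v u -> exists l, vcvg v u l }.

Definition findim_Fspace (F : finFieldType) (C : fieldType)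
    (iota : {rmorphism F -> C}) (L : set C) : Prop :=
  exists (n : nat) (b : 'I_n -> C),
    L = range (fun a : {ffun 'I_n -> F} => \sum_(i < n) iota (a i) * b i).

Definition discrete_Fspace (R : realType) (F : finFieldType) (C : fieldType)
    (iota : {rmorphism F -> C}) (v : C -> R) (L : set C) : Prop :=
  findim_Fspace iota L \/
  (exists V : nat -> set C,
     [/\ forall n, findim_Fspace iota (V n),
         forall n, V n `<=` V n.+1
       & L = \bigcup_n V n]) /\
  (forall (c : C) (r : R), finite_set (L `&` [set x | v (x - c) <= r])).

(* P is the unconditional product of f over A: the limit of the net of finite
   partial products. *)
Definition is_prod (R : realType) (C : fieldType) (v : C -> R)
    (A : set C) (f : C -> C) (P : C) : Prop :=
  forall eps : R, 0 < eps ->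
    exists2 S0 : {fset C}, [set` S0] `<=` A &
      forall S : {fset C}, [set` S0] `<=` [set` S] -> [set` S] `<=` A ->
        v (\prod_(l <- S) f l - P) < eps.

Definition e_ (R : realType) (C : fieldType) (v : C -> R) (L : set C)
    (z : C) : C :=
  z * xget 1 [set P | is_prod v (L `\ 0) (fun l => 1 - z / l) P].

Definition t_ (R : realType) (C : fieldType) (v : C -> R) (L : set C)
    (z : C) : C := (e_ v L z)^-1.

Definition is_taylor (R : realType) (C : fieldType) (v : C -> R)
    (f : C -> C) (c : C) (a : nat -> C) : Prop :=
  exists2 rho : R, 0 < rho & forall z, v (z - c) < rho ->
    vcvg v (fun n => \sum_(j < n) a j * (z - c) ^+ j) (f z).

(* The value at c of the r-th hyperderivative of f; a junk value 0 when f has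
   no Taylor expansion at c. *)
Definition hyperderiv (R : realType) (C : fieldType) (v : C -> R) (r : nat)
    (f : C -> C) (c : C) : C :=
  xget (fun=> 0) [set a | is_taylor v f c a] r.

(* The identity of formal power series in x over C[t]
     (sum_(k >= 1) G_k(t) x^k) (1 - t e_L(x)) = t x,
   where t is 'X and e_L(x) is the Taylor series of e_L at 0. *)
Definition goss_generating (R : realType) (C : fieldType) (v : C -> R)
    (L : set C) (G : nat -> {poly C}) : Prop :=
  forall k : nat,
    \sum_(1 <= i < k.+1) G i *
      ((k - i == 0)%N%:R - hyperderiv v (k - i) (e_ v L) 0 *: 'X)
    = (k == 1)%N%:R *: 'X.

(* Only the indices k >= 1 are meaningful. *)
Definition goss (R : realType) (C : fieldType) (v : C -> R) (L : set C) :
    nat -> {poly C} :=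
  xget (fun=> 0) [set G | goss_generating v L G].

Definition binz (n : int) (j : nat) : int :=
  ((\prod_(i < j) (n - i%:Z)) %/ (j`!)%:Z)%Z.

(* A Laurent polynomial sum_n P_n t^n is given by its finitely supported
   coefficient function P : int -> C. *)
Definition laurent (C : fieldType) : Type := int -> C.

Definition laurent_Xz (C : fieldType) (m : int) : laurent C :=
  fun n => (n == m)%:R.

Definition laurent_poly (C : fieldType) (p : {poly C}) : laurent C :=
  fun n => if n is Posz k then p`_k else 0.

(* t^m P *)
Definition laurent_mulXz (C : fieldType) (m : int) (P : laurent C) :
    laurent C :=
  fun n => P (n - m).

(* sum_n P_n t^n |-> sum_n P_n binom(n, j) t^(n - j) *)
Definition laurent_hyper (C : fieldType) (j : nat) (P : laurent C) :
    laurent C :=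
  fun n => P (n + j%:Z) * (binz (n + j%:Z) j)%:~R.

(* The finitely supported sum over int. *)
Definition laurent_eval (C : fieldType) (P : laurent C) (x : C) : C :=
  \sum_(n \in [set: int]) P n * x ^ n.

(* Main.v *)
(** The function e = e_L is additive, being the limit of the additive polynomials
    attached to the finite subgroups L :&: {|x| <= k}; hence
    t(z + h) = t(z) / (1 + t(z) e(h)), and expanding
    t(z + h)^n = sum_k binom(-n, k) t(z)^(n + k) e(h)^k
    in powers of h gives the hyperderivatives of t^n in terms of the coefficients
    of e(h)^k.  By the generating series, beta_(r, k) is the coefficient of x^r in
    e(x)^k, and it vanishes unless (-1)^k = (-1)^r because e is odd: this gives the
    first two identities.  The third is the comparison of the coefficients of
    x^r y^(n - 1) in e(x + y)^k = (e(x) + e(y))^k. *)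

Require Import Defs.
From HB Require Import structures.
From mathcomp Require Import all_boot all_order all_algebra finmap.
From mathcomp Require Import all_classical all_reals all_analysis.
From mathcomp Require Import zify ring.
Set Implicit Arguments.
Unset Strict Implicit.
Unset Printing Implicit Defensive.
Import Order.TTheory GRing.Theory Num.Theory.
Import numFieldNormedType.Exports.
Local Open Scope classical_set_scope.
Local Open Scope ring_scope.

(** Additivity enters as [alpha (r + m) *+ 'C(r + m, r) = 0] for positive [r] and [m]: this is the
    coefficient of x^r y^m in e(x + y) - e(x) - e(y). Stated one coefficient at a time, it survives
    both the passage from the polynomials of the finite subgroups to their limit and the truncation
    of the series, so that the formal part needs only polynomials in one variable. The limit
    requires an interchange: e is given by its values, as an unconditional product, whereas the Goss
    polynomials see its Taylor coefficients. What makes this work is a constant [rho], read off from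
    the nonzero elements of [L] of small absolute value, such that all the approximating polynomials
    have j-th coefficient at most rho^j in absolute value. Finally, a hyperderivative is chosen from
    the set of Taylor expansions at the point, so an identity theorem for power series has to
    exclude a second expansion. *)

Lemma sum_triangle (V : nmodType) (N : nat) (f : nat -> nat -> V) :
  \sum_(k < N) \sum_(j < k.+1) f j (k - j)%N =
  \sum_(j < N) \sum_(i < N - j) f j i.
Proof.
transitivity (\sum_(k < N) \sum_(j < N | (j <= k)%N) f j (k - j)%N).
  apply: eq_bigr => k _.
  by rewrite (big_ord_widen N (fun j => f j (k - j)%N)).
rewrite (exchange_big_dep xpredT)//=; apply: eq_bigr => j _.
rewrite -(big_mkord (fun k => (j <= k)%N) (fun k => f j (k - j)%N)).
rewrite -[RHS](big_mkord xpredT (f j)).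
have jN := ltnW (ltn_ord j); move: (nat_of_ord j) jN => {}j jN.
have -> : \sum_(0 <= k < N | (j <= k)%N) f j (k - j)%N =
    \sum_(j <= k < N) f j (k - j)%N.
  rewrite (big_cat_nat (leq0n j) jN) /= [X in X + _]big1_seq ?add0r => [|i].
    rewrite big_nat_cond [RHS]big_nat_cond; apply: eq_bigl => i.
    by case: (j <= i)%N; rewrite ?andbT ?andbF.
  by case/andP=> ji; rewrite mem_index_iota ltnNge ji andbF.
rewrite -{1}[j]add0n big_addn.
by apply: eq_bigr => i _; rewrite addnK.
Qed.

(** * Coefficients of powers and of additive polynomials *)

Section PolyCoefficients.
Variable C : fieldType.
Implicit Types p q : {poly C}.

Lemma eq_coefM N p q p' q' :
    (forall i, (i < N)%N -> p`_i = p'`_i) ->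
    (forall i, (i < N)%N -> q`_i = q'`_i) ->
  forall i, (i < N)%N -> (p * q)`_i = (p' * q')`_i.
Proof.
move=> pp qq i iN; rewrite !coefM; apply: eq_bigr => j _.
rewrite pp ?qq// ?(leq_ltn_trans _ iN)// ?leq_subr//.
by rewrite -ltnS.
Qed.

Lemma eq_coefX N p q :
    (forall i, (i < N)%N -> p`_i = q`_i) ->
  forall j i, (i < N)%N -> (p ^+ j)`_i = (q ^+ j)`_i.
Proof.
move=> pq; elim=> [|j IH] i iN; first by rewrite !expr0.
by rewrite !exprS (eq_coefM pq IH).
Qed.

Lemma coefX_lt0 p : p`_0 = 0 -> forall j i, (i < j)%N -> (p ^+ j)`_i = 0.
Proof.
move=> p0; elim=> [|j IH] i ij //; rewrite exprS coefM big1// => -[[|k] /= ki] _.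
  by rewrite p0 mul0r.
by rewrite IH ?mulr0// ltn_subLR// addSn ltnS (leq_trans _ (leq_addl _ _)).
Qed.

Hypothesis eval_inj : forall p, (forall x, p.[x] = 0) -> p = 0.

Lemma horner_ext p q : (forall x, p.[x] = q.[x]) -> p = q.
Proof.
move=> pq; apply/eqP; rewrite -subr_eq0; apply/eqP/eval_inj => x.
by rewrite hornerD hornerN pq subrr.
Qed.

Lemma taylor_poly p y :
  \sum_(i < size p) p^`N(i).[y] *: 'X^i = p \Po ('X + y%:P).
Proof.
apply: horner_ext => x; rewrite horner_comp horner_sum !hornerE addrC.
rewrite nderiv_taylor; last exact: mulrC.
by apply: eq_bigr => i _; rewrite hornerZ hornerXn.
Qed.

Lemma coef_shift p y r : (p \Po ('X + y%:P))`_r = p^`N(r).[y].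
Proof.
rewrite -taylor_poly coef_sum.
have [rp|pr] := ltnP r (size p).
  rewrite (bigD1 (Ordinal rp))//= coefZ coefXn eqxx mulr1 big1 ?addr0// => i ir.
  by rewrite coefZ coefXn -val_eqE/= in ir *; rewrite eq_sym (negbTE ir) mulr0.
rewrite nderivn_poly0// horner0 big1// => i _.
rewrite coefZ coefXn; case: eqP => [E|]; last by rewrite mulr0.
by move: (ltn_ord i); rewrite -E ltnNge pr.
Qed.

(** The value at y of the r-th Hasse derivative is the coefficient of X^r in p(X + y) = p(X) + p(y).
    For r > 0 it does not depend on y, so the derivative is constant and its higher coefficients
    vanish. *)
Lemma additive_poly_coef p : (forall x y, p.[x + y] = p.[x] + p.[y]) ->
  forall m r, (0 < m)%N -> (0 < r)%N -> p`_(r + m) *+ 'C(r + m, r) = 0.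
Proof.
move=> padd m r m0 r0; rewrite -coef_nderivn.
suff -> : p^`N(r) = (p`_r)%:P by rewrite coefC eqn0Ngt m0.
apply: horner_ext => y; rewrite -coef_shift hornerC.
suff -> : p \Po ('X + y%:P) = p + p.[y]%:P.
  by rewrite coefD coefC eqn0Ngt r0 addr0.
by apply: horner_ext => x; rewrite horner_comp !hornerE padd.
Qed.

Lemma coef_additive_poly p : p`_0 = 0 ->
  (forall m r, (0 < m)%N -> (0 < r)%N -> p`_(r + m) *+ 'C(r + m, r) = 0) ->
  forall y, p \Po ('X + y%:P) = p + p.[y]%:P.
Proof.
move=> p0 padd y; apply/polyP => -[|r].
  by rewrite coef_shift nderivn0 coefD coefC p0 add0r.
rewrite coef_shift coefD coefC addr0.
suff -> : p^`N(r.+1) = (p`_r.+1)%:P by rewrite hornerC.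
apply/polyP => -[|m]; rewrite coef_nderivn coefC /=.
  by rewrite addn0 binn.
exact: padd.
Qed.

(** Compares the coefficients of X^r y^m in p(X + y)^k = (p(X) + p(y))^k. The second variable is
    avoided: the coefficient of X^r, as a function of y, is the r-th Hasse derivative of p^k, whose
    m-th coefficient is then read off. *)
Lemma coef_additive_polyX p : p`_0 = 0 ->
  (forall m r, (0 < m)%N -> (0 < r)%N -> p`_(r + m) *+ 'C(r + m, r) = 0) ->
  forall k m r, (p ^+ k)`_(r + m) *+ 'C(r + m, r) =
    \sum_(j < k.+1) ((p ^+ j)`_r * (p ^+ (k - j))`_m) *+ 'C(k, j).
Proof.
move=> p0 padd k m r; rewrite -coef_nderivn.
suff -> : (p ^+ k)^`N(r) =
    \sum_(j < k.+1) (p ^+ j)`_r *: p ^+ (k - j) *+ 'C(k, j).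
  by rewrite coef_sum; apply: eq_bigr => j _; rewrite coefMn coefZ.
apply: horner_ext => y; rewrite -coef_shift.
rewrite rmorphXn /= coef_additive_poly// addrC exprDn coef_sum horner_sum.
apply: eq_bigr => j _; rewrite coefMn hornerMn hornerZ horner_exp.
by rewrite -polyC_exp coefCM mulrC.
Qed.

End PolyCoefficients.

(** * Powers of a formal power series without constant term *)

Section SeriesPowers.
Variables (C : fieldType) (alpha : nat -> C).
Hypothesis alpha0 : alpha 0%N = 0.

Definition trunc_series N : {poly C} := \poly_(i < N) alpha i.

(** The coefficient of x^r in e(x)^j, where e is the series with coefficients [alpha]; terms of e
    beyond degree r do not affect it. *)
Definition spow (r j : nat) : C := (trunc_series r.+1 ^+ j)`_r.

Lemma coef_trunc_series N i : (i < N)%N -> (trunc_series N)`_i = alpha i.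
Proof. by move=> iN; rewrite coef_poly iN. Qed.

Lemma coef_trunc_seriesX N r j : (r < N)%N ->
  (trunc_series N ^+ j)`_r = spow r j.
Proof.
move=> rN; apply: (@eq_coefX _ r.+1) => // i ir.
by rewrite !coef_trunc_series// (leq_trans ir).
Qed.

Lemma trunc_series0 N : (trunc_series N)`_0 = 0.
Proof. by rewrite coef_poly alpha0 if_same. Qed.

Lemma spow0 r : spow r 0 = (r == 0%N)%:R.
Proof. by rewrite /spow expr0 coef1. Qed.

Lemma spow_gt r j : (r < j)%N -> spow r j = 0.
Proof. by move=> rj; rewrite /spow coefX_lt0// trunc_series0. Qed.

Lemma spowS r j : spow r j.+1 = \sum_(i < r.+1) alpha i * spow (r - i) j.
Proof.
rewrite /spow exprS coefM; apply: eq_bigr => i _.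
by rewrite coef_trunc_series// coef_trunc_seriesX// ltnS leq_subr.
Qed.

Section InversePowers.
Variable t : C.

(* The coefficients of (1 + t e(x))^-n = sum_k binom(-n, k) (t e(x))^k. *)
Definition winv (n r : nat) : C :=
  \sum_(k < r.+1) 'C(n + k - 1, k)%:R * (- t) ^+ k * spow r k.

Lemma winv_wide N n r : (r < N)%N ->
  winv n r = \sum_(k < N) 'C(n + k - 1, k)%:R * (- t) ^+ k * spow r k.
Proof.
move=> rN; rewrite /winv.
rewrite (big_ord_widen N (fun k => 'C(n + k - 1, k)%:R * (- t) ^+ k * spow r k))//.
rewrite big_mkcond /=; apply: eq_bigr => k _.
by case: ltnP => // /spow_gt->; rewrite mulr0.
Qed.

Lemma winv0 r : winv 0 r = (r == 0%N)%:R.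
Proof.
rewrite /winv big_ord_recl big1 ?addr0 => [|i _]; last first.
  by rewrite /= add0n subn1 bin_small// !mul0r.
by rewrite bin0 expr0 !mul1r spow0.
Qed.

(** The formal identity (1 + t e) (1 + t e)^-(n+1) = (1 + t e)^-n, proved by Pascal's rule. With
    [winv0] it determines all these series by recursion on the exponent, which is how their sums are
    computed later. *)
Lemma winvS n r :
  \sum_(i < r.+1) ((i == 0%N :> nat)%:R + t * alpha i) * winv n.+1 (r - i) =
  winv n r.
Proof.
pose A := trunc_series r.+1.
pose W m := \sum_(k < r.+1) ('C(m + k - 1, k)%:R * (- t) ^+ k) *: A ^+ k.
have WE m i : (i < r.+1)%N -> (W m)`_i = winv m i.
  move=> ir; rewrite (@winv_wide r.+1)// coef_sum; apply: eq_bigr => k _.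
  by rewrite coefZ coef_trunc_seriesX.
transitivity (((1 + t *: A) * W n.+1)`_r).
  rewrite coefM; apply: eq_bigr => i _.
  by rewrite WE ?ltnS ?leq_subr// coefD coef1 coefZ coef_trunc_series.
rewrite -WE//.
(* Cutting the sum over [k] at [r] leaves one boundary term, a multiple of [A ^+ r.+1]; as [A] has
   no constant term, it has no coefficient in degree [r]. *)
suff -> : (1 + t *: A) * W n.+1 =
    W n - ('C(n + r, r)%:R * (- t) ^+ r.+1) *: A ^+ r.+1.
  by rewrite coefB coefZ (@coefX_lt0 _ A) ?trunc_series0// mulr0 subr0.
rewrite mulrDl mul1r {1}/W big_ord_recl /W [in RHS]big_ord_recl /=.
rewrite !bin0 -!addrA; congr (_ + _).
rewrite mulr_sumr big_ord_recr /= addrA -big_split /=; congr (_ + _); last first.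
  rewrite -scalerAl -scalerAr scalerA -exprS -scaleNr addSn subn1 /=.
  by congr (_ *: _); rewrite mulrCA -mulrN exprS mulNr opprK.
apply: eq_bigr => k _; rewrite /bump leq0n add1n.
rewrite !addSn !addnS !subn1 /= -scalerAl -scalerAr scalerA -exprS.
rewrite -scalerDl; congr (_ *: _).
by rewrite binS natrD mulrDl -addrA mulrCA -mulrDr exprS mulNr addNr mulr0 addr0.
Qed.

End InversePowers.

(** * Goss polynomials *)

(** The coefficient of x^k in the geometric series t x / (1 - t e(x)) = sum_j t^(j+1) x e(x)^j; the
    factor x accounts for [k.-1]. *)
Definition goss_poly (k : nat) : {poly C} := \sum_(j < k) spow k.-1 j *: 'X^(j.+1).

Lemma goss_poly_generating k :
  \sum_(1 <= i < k.+1) goss_poly i * ((k - i == 0)%N%:R - alpha (k - i) *: 'X)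
  = (k == 1)%N%:R *: 'X.
Proof.
case: k => [|r]; first by rewrite big_geq// scale0r.
rewrite big_add1 /= big_mkord.
under eq_bigr do rewrite subSS mulrBr.
rewrite sumrB big_ord_recr /= subnn eqxx mulr1 big1 ?add0r; last first.
  by move=> i _; rewrite subn_eq0 leqNgt ltn_ord mulr0.
rewrite {1}/goss_poly big_ord_recl spow0 eqSS expr1.
suff -> : \sum_(i < r.+1) goss_poly i.+1 * (alpha (r - i)%N *: 'X) =
          \sum_(j < r) spow r (bump 0 j) *: 'X^((bump 0 j).+1).
  by rewrite /= addrK.
transitivity (\sum_(i < r.+1) \sum_(j < r.+1)
    (spow i j * alpha (r - i)%N) *: 'X^(j.+2) : {poly C}).
  apply: eq_bigr => i _; rewrite /goss_poly mulr_suml /=.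
  rewrite (big_ord_widen r.+1
    (fun j => spow i j *: 'X^(j.+1) * (alpha (r - i)%N *: 'X)))//.
  rewrite big_mkcond; apply: eq_bigr => j _; case: ltnP => [_|ij].
    by rewrite -scalerAl -scalerAr scalerA -exprSr.
  by rewrite spow_gt// mul0r scale0r.
rewrite exchange_big /=.
transitivity (\sum_(j < r.+1) spow r j.+1 *: 'X^(j.+2) : {poly C}).
  apply: eq_bigr => j _; rewrite -scaler_suml; congr (_ *: _).
  rewrite spowS (reindex_inj rev_ord_inj) /=; apply: eq_bigr => i _.
  by rewrite subSS subKn 1?mulrC// -ltnS.
by rewrite big_ord_recr /= spow_gt// scale0r addr0.
Qed.

(** The system is triangular with diagonal entries 1, because [alpha] vanishes at 0. It leaves [G 0]
    free. *)
Lemma goss_poly_unique (G : nat -> {poly C}) :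
    (forall k, \sum_(1 <= i < k.+1)
       G i * ((k - i == 0)%N%:R - alpha (k - i) *: 'X) = (k == 1)%N%:R *: 'X) ->
  forall k, (0 < k)%N -> G k = goss_poly k.
Proof.
move=> HG; elim/ltn_ind => k IH k0.
have := HG k; rewrite -(goss_poly_generating k) !big_nat_recr//= subnn eqxx.
rewrite alpha0 scale0r subr0 !mulr1.
rewrite (eq_big_nat _ _ (F2 := fun i => goss_poly i *
    ((k - i == 0)%N%:R - alpha (k - i) *: 'X))); first by move/addrI.
by move=> i /andP[i0 ik]; rewrite IH.
Qed.

Lemma coef_goss_poly r j : (j <= r)%N -> (goss_poly r.+1)`_j.+1 = spow r j.
Proof.
move=> jr; rewrite coef_sum.
have jr' : (j < r.+1)%N by [].
rewrite (bigD1 (Ordinal jr'))//= coefZ coefXn eqxx mulr1 big1 ?addr0// => i ij.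
by rewrite coefZ coefXn eqSS eq_sym -val_eqE/= in ij *; rewrite (negbTE ij) mulr0.
Qed.

(** * Formal additivity *)

Hypothesis eval_inj : forall p : {poly C}, (forall x, p.[x] = 0) -> p = 0.
Hypothesis alpha_add : forall m r, (0 < m)%N -> (0 < r)%N ->
  alpha (r + m) *+ 'C(r + m, r) = 0.

(* Set y = -x in e(x + y) = e(x) + e(y). *)
Lemma alpha_odd i : (-1) ^+ i * alpha i = - alpha i.
Proof.
case: i => [|i]; first by rewrite alpha0 mulr0 oppr0.
apply/eqP; rewrite -addr_eq0 -[X in _ + X]mul1r -mulrDl.
have : (1 - 1 : C) ^+ i.+1 * alpha i.+1 = 0 by rewrite subrr expr0n mul0r.
rewrite exprDn big_ord_recl big_ord_recr /= bin0 binn !expr1n !mul1r !mulr1n.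
rewrite [X in _ + (X + _)](_ : _ = \sum_(j < i) (-1) ^+ j.+1 *+ 'C(i.+1, j.+1)).
  rewrite !mulrDl mulr_suml big1 => [|j _].
    by rewrite add0r -mulrDl mulrDl addrC -mulrDl => ->.
  have ji := ltn_ord j.
  rewrite mulrnAl -mulrnAr -[in alpha _](subnKC (ltnW ji : j < i.+1)%N).
  rewrite -[in 'C(_, _)](subnKC (ltnW ji : j < i.+1)%N).
  by rewrite alpha_add ?mulr0// subn_gt0 ltnS.
by apply: eq_bigr => j _; rewrite expr1n mul1r /bump leq0n add1n.
Qed.

(** This is e(-x)^j = (-1)^j e(x)^j. It compares signs instead of asserting a vanishing for r + j
    odd, which could fail in characteristic 2. *)
Lemma spow_odd r j : (-1) ^+ r * spow r j = (-1) ^+ j * spow r j.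
Proof.
elim: j r => [|j IH] r.
  by rewrite spow0; case: r => [|r]; rewrite ?mulr0.
rewrite spowS !mulr_sumr; apply: eq_bigr => i _.
have ir : (i <= r)%N by rewrite -ltnS.
have -> : (-1) ^+ r = (-1) ^+ i * (-1) ^+ (r - i) :> C by rewrite -exprD subnKC.
rewrite -mulrA [X in _ * X]mulrCA IH.
rewrite mulrA alpha_odd exprS mulN1r !mulNr; congr (- _); exact: mulrCA.
Qed.

Lemma spow_add k m r : spow (r + m) k *+ 'C(r + m, r) =
  \sum_(j < k.+1) (spow r j * spow m (k - j)) *+ 'C(k, j).
Proof.
pose N := (r + m).+1.
have := @coef_additive_polyX _ eval_inj (trunc_series N) (trunc_series0 N) _ k m r.
rewrite coef_trunc_seriesX// => ->.
  by apply: eq_bigr => j _; rewrite !coef_trunc_seriesX// ltnS ?leq_addl ?leq_addr.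
move=> m' r' m0 r0; rewrite coef_poly; case: ifP => _; last by rewrite mul0rn.
exact: alpha_add.
Qed.

(** Splitting k = i + j in [spow_add] gives a sum over the triangle i + j <= r + m. It contains the
    rectangle j <= r, i <= m, and outside the rectangle one of the two factors [spow] vanishes. *)
Lemma goss_poly_binom (r m : nat) (x : C) :
  'C(r + m, r)%:R * (goss_poly (r + m).+1).[x] =
  \sum_(j < r.+1) \sum_(i < m.+1)
    spow r j * spow m i * 'C(i + j, j)%:R * x ^+ (i + j).+1.
Proof.
pose f j i := spow r j * spow m i * 'C(i + j, j)%:R * x ^+ (i + j).+1.
rewrite /goss_poly horner_sum mulr_sumr /=.
transitivity (\sum_(k < (r + m).+1) \sum_(j < k.+1) f j (k - j)%N).
  apply: eq_bigr => k _; rewrite hornerZ hornerXn mulrA mulr_natl spow_add.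
  rewrite mulr_suml; apply: eq_bigr => j _; rewrite /f subnK; last by rewrite -ltnS.
  by rewrite mulr_natr.
rewrite sum_triangle.
have f0 j i : (r < j)%N || (m < i)%N -> f j i = 0.
  by case/orP => /spow_gt E; rewrite /f E ?mulr0 !mul0r.
rewrite [RHS](big_ord_widen (r + m).+1 (fun j => \sum_(i < m.+1) f j i)); last first.
  by rewrite ltnS leq_addr.
rewrite [RHS]big_mkcond; apply: eq_bigr => j _; case: ltnP => rj; last first.
  by rewrite big1// => i _; rewrite f0// rj.
rewrite [RHS](big_ord_widen ((r + m).+1 - j) (f j)); last first.
  by rewrite ltn_subRL ltnS leq_add2r.
rewrite [RHS]big_mkcond; apply: eq_bigr => i _; case: ltnP => // mi.
by rewrite f0// mi orbT.
Qed.

End SeriesPowers.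

(** * Power series over a nonarchimedean field *)

Section Nonarch.
Variables (R : realType) (C : fieldType) (v : C -> R).
Hypothesis hv : nonarch_abs v.
Implicit Types (x y z h : C) (a b c : nat -> C).

Let v_ge0 := nabs_ge0 hv.
Let vM := nabsM hv.

Lemma nabs0 : v 0 = 0. Proof. exact/(nabs_eq0 hv). Qed.

Lemma nabs_gt0 x : x != 0 -> 0 < v x.
Proof.
move=> x0; rewrite lt_def v_ge0 andbT; apply: contra x0 => /eqP.
by move/(nabs_eq0 hv)/eqP.
Qed.

Lemma nabs1 : v 1 = 1.
Proof.
have := nabs_gt0 (oner_neq0 C); have := vM 1 1; rewrite mulr1 => E v1.
by apply: (mulfI (lt0r_neq0 v1)); rewrite -E mulr1.
Qed.

Lemma nabsX x n : v (x ^+ n) = v x ^+ n.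
Proof. by elim: n => [|n IH]; rewrite ?expr0 ?nabs1// !exprS vM IH. Qed.

Lemma nabsN x : v (- x) = v x.
Proof.
have : v (-1) ^+ 2 = 1 by rewrite -nabsX sqrrN expr1n nabs1.
by move/eqP; rewrite sqrp_eq1// => /eqP E; rewrite -mulN1r vM E mul1r.
Qed.

Lemma nabsBC x y : v (x - y) = v (y - x).
Proof. by rewrite -nabsN opprB. Qed.

Lemma nabsV x : v x^-1 = (v x)^-1.
Proof.
have [->|x0] := eqVneq x 0; first by rewrite invr0 nabs0 invr0.
have v0 := lt0r_neq0 (nabs_gt0 x0).
by apply: (mulfI v0); rewrite -vM !divff// nabs1.
Qed.

Lemma nabsD_le x y (e : R) : v x <= e -> v y <= e -> v (x + y) <= e.
Proof. by move=> xe ye; apply: le_trans (nabsD hv _ _) _; rewrite ge_max xe. Qed.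

Lemma nabsD_lt x y (e : R) : v x < e -> v y < e -> v (x + y) < e.
Proof. by move=> xe ye; apply: le_lt_trans (nabsD hv _ _) _; rewrite gt_max xe. Qed.

Lemma nabsB_lt x y (e : R) : v x < e -> v y < e -> v (x - y) < e.
Proof. by move=> xe ye; apply: nabsD_lt => //; rewrite nabsN. Qed.

Lemma nabs_dist_lt x y z (e : R) : v (x - y) < e -> v (y - z) < e -> v (x - z) < e.
Proof. by move=> xy yz; rewrite -(subrKA y); apply: nabsD_lt. Qed.

Lemma nabs_sum_le (I : Type) (r : seq I) (P : pred I) (F : I -> C) (e : R) :
  0 <= e -> (forall i, P i -> v (F i) <= e) -> v (\sum_(i <- r | P i) F i) <= e.
Proof.
move=> e0 Fe; apply: (big_ind (fun x => v x <= e)) => //; first by rewrite nabs0.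
by move=> x y; apply: nabsD_le.
Qed.

Lemma nabs_nat n : v n%:R <= 1.
Proof.
elim: n => [|n IH]; first by rewrite nabs0.
by rewrite -natr1 nabsD_le// nabs1.
Qed.

Lemma nabs_isosceles x y : v (x - y) < v y -> v x = v y.
Proof.
move=> xy; apply/eqP; rewrite eq_le; apply/andP; split.
  by rewrite -[x](subrK y) nabsD_le// ltW.
rewrite leNgt; apply/negP => yx.
suff : v y < v y by rewrite ltxx.
by rewrite -{1}[y](subKr x); apply: nabsB_lt.
Qed.

Lemma vcvgP (u : nat -> C) l : vcvg v u l <->
  forall e : R, 0 < e -> exists N, forall n, (N <= n)%N -> v (u n - l) < e.
Proof.
rewrite /vcvg; split.
  move/cvgr0Pnorm_lt => H e e0; have [N _ HN] := H e e0.
  exists N => n /HN /=; exact: le_lt_trans (ler_norm _).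
move=> H; apply/cvgr0Pnorm_lt => e e0; have [N HN] := H e e0.
by exists N => // n /= /HN; rewrite ger0_norm.
Qed.

Lemma vcvg_unique (u : nat -> C) l l' : vcvg v u l -> vcvg v u l' -> l = l'.
Proof.
move=> /vcvgP ul /vcvgP ul'; apply/eqP; rewrite -subr_eq0.
apply/negPn/negP => /nabs_gt0 d0.
have [N HN] := ul _ d0; have [N' HN'] := ul' _ d0.
have := nabs_dist_lt (y := u (maxn N N')) (x := l) (z := l') (e := v (l - l')).
rewrite ltxx nabsBC => H; suff : false by []; apply: H.
  by apply: HN; rewrite leq_maxl.
by apply: HN'; rewrite leq_maxr.
Qed.

Lemma vcvg_cst l : vcvg v (fun=> l) l.
Proof. by apply/vcvgP => e e0; exists 0%N => n _; rewrite subrr nabs0. Qed.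

Lemma vcvgD (u u' : nat -> C) l l' :
  vcvg v u l -> vcvg v u' l' -> vcvg v (fun n => u n + u' n) (l + l').
Proof.
move=> /vcvgP ul /vcvgP ul'; apply/vcvgP => e e0.
have [N HN] := ul _ e0; have [N' HN'] := ul' _ e0.
exists (maxn N N') => n; rewrite geq_max => /andP[nN nN'].
by rewrite opprD addrACA nabsD_lt ?HN ?HN'.
Qed.

Lemma vcvgZ (u : nat -> C) l x : vcvg v u l -> vcvg v (fun n => x * u n) (x * l).
Proof.
have [->|x0] := eqVneq x 0.
  by rewrite mul0r => _; under eq_fun do rewrite mul0r; exact: vcvg_cst.
move=> /vcvgP ul; apply/vcvgP => e e0; have vx := nabs_gt0 x0.
have [N HN] := ul _ (divr_gt0 e0 vx).
by exists N => n /HN; rewrite ltr_pdivlMr// mulrC -vM mulrBr.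
Qed.

Lemma eq_vcvg (u u' : nat -> C) l : u =1 u' -> vcvg v u l -> vcvg v u' l.
Proof. by move=> /funext->. Qed.

Lemma vcvg_sub0 (u u' : nat -> C) l :
  vcvg v u l -> vcvg v (fun n => u' n - u n) 0 -> vcvg v u' l.
Proof.
move=> ul uu'; have := vcvgD ul uu'; rewrite addr0.
by apply: eq_vcvg => n; rewrite addrC subrK.
Qed.

Lemma vcvg_nabs_bound (u : nat -> C) l : vcvg v u l ->
  exists2 M : R, 0 < M & forall n, v (u n) <= M.
Proof.
move=> /vcvgP/(_ 1 ltr01)[N HN].
exists (v l + 1 + \sum_(i < N) v (u i)).
  by rewrite ltr_wpDr ?sumr_ge0// ltr_wpDl.
move=> n; have [nN|/HN H] := ltnP n N.
  rewrite (bigD1 (Ordinal nN))//= addrCA ler_wpDr// addr_ge0 ?addr_ge0//.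
  exact: sumr_ge0.
rewrite ler_wpDr ?sumr_ge0//; apply: le_trans (_ : Num.max (v (u n - l)) (v l) <= _).
  by rewrite -{1}(subrK l (u n)); exact: nabsD.
rewrite ge_max ler_wpDl//=; last exact: ltW.
by rewrite lerDl.
Qed.

Lemma vcvgM (u u' : nat -> C) l l' :
  vcvg v u l -> vcvg v u' l' -> vcvg v (fun n => u n * u' n) (l * l').
Proof.
move=> ul ul'; apply: (@vcvg_sub0 (fun n => u n * l')).
  by rewrite mulrC; apply: eq_vcvg (vcvgZ l' ul) => n; rewrite mulrC.
have [M M0 uM] := vcvg_nabs_bound ul; move/vcvgP: ul' => ul'.
apply/vcvgP => e e0; have [N HN] := ul' _ (divr_gt0 e0 M0).
exists N => n /HN; rewrite ltr_pdivlMr// => H.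
rewrite subr0 -mulrBr vM; apply: le_lt_trans H.
by rewrite mulrC ler_wpM2l.
Qed.

Lemma exprn_small (x e : R) : 0 <= x -> x < 1 -> 0 < e ->
  exists N, forall n, (N <= n)%N -> x ^+ n < e.
Proof.
move=> x0 x1 e0; have : `|x| < 1 by rewrite ger0_norm.
move/cvg_expr/cvgr0Pnorm_lt/(_ e e0) => [N _ HN].
by exists N => n /HN /=; rewrite ger0_norm// exprn_ge0.
Qed.

(** A bound without a multiplicative constant: by the ultrametric inequality it is stable under
    products of any number of factors, with the same [rho]. It gives convergence where
    [rho * v h < 1]. *)
Definition pow_bounded (rho : R) a := forall j, v (a j) <= rho ^+ j.

Definition psum a h (n : nat) : C := \sum_(j < n) a j * h ^+ j.

Lemma pow_bounded_term rho a h j n : 0 <= rho -> pow_bounded rho a ->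
  rho * v h < 1 -> (n <= j)%N -> v (a j * h ^+ j) <= (rho * v h) ^+ n.
Proof.
move=> rho0 arho rh nj.
apply: (@le_trans _ _ ((rho * v h) ^+ j)).
  by rewrite vM nabsX exprMn ler_wpM2r ?exprn_ge0.
by rewrite ler_wiXn2l// ?mulr_ge0// ltW.
Qed.

Lemma psum_tail rho a h m n : 0 <= rho -> pow_bounded rho a ->
  rho * v h < 1 -> (n <= m)%N -> v (psum a h m - psum a h n) <= (rho * v h) ^+ n.
Proof.
move=> rho0 arho rh nm.
rewrite /psum -!(big_mkord xpredT (fun j => a j * h ^+ j)).
rewrite (big_cat_nat (leq0n n) nm) /= addrAC subrr add0r big_nat.
apply: nabs_sum_le => [|j /andP[nj _]]; first by rewrite exprn_ge0// mulr_ge0.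
exact: pow_bounded_term.
Qed.

Hypothesis v_complete : forall u : nat -> C, vcauchy v u -> exists l, vcvg v u l.

Lemma psum_cvg rho a h : 0 <= rho -> pow_bounded rho a -> rho * v h < 1 ->
  exists l, vcvg v (psum a h) l.
Proof.
move=> rho0 arho rh; apply: v_complete => e e0.
have [N HN] := exprn_small (mulr_ge0 rho0 (v_ge0 h)) rh e0.
have H m n : (N <= n)%N -> (n <= m)%N -> v (psum a h m - psum a h n) < e.
  by move=> Nn nm; apply: le_lt_trans (psum_tail rho0 arho rh nm) (HN _ Nn).
exists N => m n Nm Nn; have [|/ltnW] := leqP n m; first exact: H.
by rewrite nabsBC; exact: H.
Qed.

Lemma pow_boundedM rho (p q : {poly C}) : 0 <= rho ->
  pow_bounded rho (nth 0 p) -> pow_bounded rho (nth 0 q) ->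
  pow_bounded rho (nth 0 (p * q)).
Proof.
move=> rho0 pr qr j; rewrite coefM; apply: nabs_sum_le => [|i _].
  exact: exprn_ge0.
have ij : (i <= j)%N by rewrite -ltnS.
have -> : rho ^+ j = rho ^+ i * rho ^+ (j - i) by rewrite -exprD subnKC.
by rewrite vM ler_pM.
Qed.

Lemma pow_bounded1 rho : 0 <= rho -> pow_bounded rho (nth 0 (1 : {poly C})).
Proof.
move=> rho0 j; rewrite coef1.
by case: j => [|j] /=; rewrite ?nabs1 ?nabs0 ?expr0// exprn_ge0.
Qed.

(** The product of the n-th partial sums and the n-th partial sum of the product agree below degree
    n; each remaining term is at most (rho |h|)^n, and so is their sum. *)
Lemma psum_mul rho a b c h x y : 0 <= rho ->
  pow_bounded rho a -> pow_bounded rho b -> rho * v h < 1 ->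
  (forall r, c r = \sum_(i < r.+1) a i * b (r - i)%N) ->
  vcvg v (psum a h) x -> vcvg v (psum b h) y -> vcvg v (psum c h) (x * y).
Proof.
move=> rho0 arho brho rh cE ax by_.
apply: vcvg_sub0 (vcvgM ax by_) _; apply/vcvgP => e e0.
have [N HN] := exprn_small (mulr_ge0 rho0 (v_ge0 h)) rh e0.
exists N => n /HN; apply: le_lt_trans; rewrite subr0 nabsBC.
pose tr (d : nat -> C) : {poly C} := \poly_(i < n) d i.
have trE d : psum d h n = (tr d).[h] by rewrite horner_poly.
have trb d : pow_bounded rho d -> pow_bounded rho (nth 0 (tr d)).
  move=> dr j; rewrite coef_poly; case: ifP => // _; rewrite nabs0; exact: exprn_ge0.
rewrite !trE -hornerM -hornerN -hornerD horner_coef.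
apply: nabs_sum_le => [|j _]; first by rewrite exprn_ge0// mulr_ge0.
have [jn|nj] := ltnP j n.
  rewrite coefB [(tr c)`_j]coef_poly jn cE coefM.
  rewrite [X in X - _](_ : _ = \sum_(i < j.+1) a i * b (j - i)%N).
    by rewrite subrr mul0r nabs0 exprn_ge0// mulr_ge0.
  apply: eq_bigr => i _; have ij : (i <= j)%N by rewrite -ltnS.
  by rewrite !coef_poly !(leq_ltn_trans _ jn)// leq_subr.
rewrite coefB [(tr c)`_j]coef_poly ltnNge nj subr0.
apply: pow_bounded_term => //; apply: pow_boundedM => //; exact: trb.
Qed.

Hypothesis v_small : forall e : R, 0 < e -> exists2 h, h != 0 & v h < e.

(** At the first nonzero coefficient, that term strictly dominates all later ones for small h, so
    the long partial sums keep its absolute value and cannot tend to 0. *)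
Lemma psum0_eq0 a (rho : R) : 0 < rho ->
  (forall h, v h < rho -> vcvg v (psum a h) 0) -> forall j, a j = 0.
Proof.
move=> rho0 Ha; elim/ltn_ind => j IH.
have [h0 h00 h0r] := v_small rho0; have vh0 := nabs_gt0 h00.
apply/eqP/negPn/negP => aj; have vaj := nabs_gt0 aj.
have [M M0 HM] := vcvg_nabs_bound (Ha _ h0r).
have termM i : v (a i) * v h0 ^+ i <= M.
  rewrite -nabsX -vM; have -> : a i * h0 ^+ i = psum a h0 i.+1 - psum a h0 i.
    by rewrite /psum big_ord_recr /= addrAC subrr add0r.
  by apply: nabsD_le; rewrite ?nabsN.
(* Since [M] bounds every term at [h0], this radius makes all terms of degree i > j smaller than the
   j-th one at once: |a_i h^i| |h0|^(j+1) <= M |h| |h|^j. *)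
have e0 : 0 < Num.min (v h0) (v (a j) * v h0 ^+ j.+1 / M).
  by rewrite lt_min vh0 divr_gt0// mulr_gt0// exprn_gt0.
have [h h00' hlt] := v_small e0; have vh := nabs_gt0 h00'.
move: hlt; rewrite lt_min => /andP[hh0]; rewrite ltr_pdivlMr// => hM.
have small i : (j < i)%N -> v (a i * h ^+ i) < v (a j * h ^+ j).
  move=> ji; rewrite !vM !nabsX.
  have qle : v h ^+ (i - j.+1) <= v h0 ^+ (i - j.+1).
    by rewrite lerXn2r ?nnegrE// ltW.
  have H1 : v (a i) * v h0 ^+ (i - j.+1) * v h0 ^+ j.+1 <= M.
    by rewrite -mulrA -exprD subnK.
  have p0 : 0 < v h0 ^+ j.+1 by rewrite exprn_gt0.
  have -> : v h ^+ i = v h ^+ (i - j.+1) * (v h * v h ^+ j).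
    by rewrite -exprS -exprD subnK.
  rewrite -(ltr_pM2r p0).
  apply: (@le_lt_trans _ _
    (v (a i) * v h0 ^+ (i - j.+1) * v h0 ^+ j.+1 * (v h * v h ^+ j))).
    rewrite [leRHS]mulrAC ler_wpM2r ?exprn_ge0// mulrA.
    by rewrite ler_wpM2r ?mulr_ge0 ?exprn_ge0// ler_wpM2l.
  apply: (@le_lt_trans _ _ (M * (v h * v h ^+ j))).
    by rewrite ler_wpM2r// mulr_ge0 ?exprn_ge0.
  by rewrite mulrA [ltRHS]mulrAC ltr_pM2r ?exprn_gt0// mulrC.
have vajh : 0 < v (a j * h ^+ j) by rewrite vM nabsX mulr_gt0// exprn_gt0.
have /vcvgP/(_ _ vajh)[N HN] := Ha h (lt_trans hh0 h0r).
have := HN (N + j.+1)%N (leq_addr _ _); rewrite subr0.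
suff -> : v (psum a h (N + j.+1)) = v (a j * h ^+ j) by rewrite ltxx.
have jlt : (j < N + j.+1)%N by rewrite addnS ltnS leq_addl.
rewrite /psum (bigD1 (Ordinal jlt))//=; apply: nabs_isosceles.
rewrite addrAC subrr add0r.
apply: (big_ind (fun x => v x < v (a j * h ^+ j))); first by rewrite nabs0.
  by move=> x y; exact: nabsD_lt.
move=> i; rewrite -val_eqE /= => ij; have [lij|jli|E] := ltngtP i j.
- by rewrite IH// mul0r nabs0.
- exact: small.
- by rewrite E eqxx in ij.
Qed.

Lemma taylor_unique f x a b : is_taylor v f x a -> is_taylor v f x b -> a = b.
Proof.
move=> [ra ra0 Ha] [rb rb0 Hb]; apply/funext => j; apply/eqP; rewrite -subr_eq0.
apply/eqP; apply: (@psum0_eq0 (fun j => a j - b j) (Num.min ra rb)).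
  by rewrite lt_min ra0.
move=> h; rewrite lt_min => /andP[hra hrb].
have hE : h = (x + h) - x by rewrite addrAC subrr add0r.
have := vcvgD (Ha (x + h) _) (vcvgZ (-1) (Hb (x + h) _)).
rewrite -hE => /(_ hra hrb); rewrite mulN1r subrr; apply: eq_vcvg => n.
by rewrite mulN1r -sumrB; apply: eq_bigr => i _; rewrite mulrBl.
Qed.

Lemma hyperderivE f x a r : is_taylor v f x a -> hyperderiv v r f x = a r.
Proof.
move=> fa; rewrite /hyperderiv (xget_unique _ fa)// => b /=.
by move=> /taylor_unique /(_ fa).
Qed.

End Nonarch.

(** * The exponential function of a discrete additive subgroup *)

(* Translating by an element of A permutes the roots, so
   N(X + y) - N(X) - N(y) has degree < #|A| and vanishes on A. *)
Lemma subgroup_poly_additive (C : fieldType) (A : {fset C}) :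
    0 \in A -> (forall x y, x \in A -> y \in A -> x - y \in A) ->
  let N := \prod_(l <- A) ('X - l%:P) : {poly C} in
  forall x y, N.[x + y] = N.[x] + N.[y].
Proof.
move=> A0 AB N x y.
have AN a : a \in A -> - a \in A by move=> aA; rewrite -[- a]add0r AB.
have N_trans a : a \in A -> N.[a + y] = N.[y].
  move=> aA; rewrite /N !horner_prod.
  transitivity (\prod_(l <- [seq l - a | l <- A]) ('X - l%:P).[y]).
    rewrite big_map; apply: eq_bigr => l _.
    by rewrite !hornerXsubC opprB addrA (addrC a).
  apply: perm_big; apply: uniq_perm => [||b].
  - by rewrite map_inj_uniq ?fset_uniq//; exact: addIr.
  - exact: fset_uniq.
  apply/mapP/idP => [[l lA ->]|bA]; first exact: AB.
  by exists (b + a); rewrite ?addrK// -[a]opprK AB// AN.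
have N_root a : a \in A -> N.[a] = 0.
  by move=> aA; apply/rootP; rewrite root_prod_XsubC.
pose q := N \Po ('X + y%:P) - N - N.[y]%:P.
suff q0 : q = 0.
  have /(congr1 (fun p : {poly C} => p.[x])) := q0.
  rewrite /q !hornerD !hornerN hornerC horner_comp !hornerE => /eqP.
  by rewrite subr_eq0 subr_eq => /eqP->; rewrite addrC.
apply/eqP/negPn/negP => q0.
have rq : all (root q) A.
  apply/allP => a aA; apply/rootP.
  rewrite /q !hornerD !hornerN hornerC horner_comp !hornerE.
  by rewrite N_trans// (N_root a)// subr0 subrr.
have := max_poly_roots q0 rq (fset_uniq A); rewrite ltnNge => /negP; apply.
have NS : N \Po ('X + y%:P) = \prod_(l <- A) ('X - (l - y)%:P).
  rewrite /N rmorph_prod /=; apply: eq_bigr => l _.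
  by rewrite comp_polyB comp_polyX comp_polyC polyCB opprB addrA addrAC.
have sz (F : C -> C) : size (\prod_(l <- A) ('X - (F l)%:P)) = (size A).+1.
  by rewrite size_prod_XsubC.
have mon (F : C -> C) : (\prod_(l <- A) ('X - (F l)%:P))`_(size A) = 1.
  have /monicP := monic_prod_XsubC A xpredT F.
  by rewrite lead_coefE sz.
apply/leq_sizeP => j jA; rewrite /q NS !coefB coefC.
have A0' : (0 < size A)%N.
  by move: A0; rewrite -has_pred1 has_count => /leq_trans ->//; exact: count_size.
rewrite eqn0Ngt (leq_trans A0' jA) subr0.
move: jA; rewrite leq_eqVlt => /orP[/eqP <-|jA].
  by rewrite mon (mon id) subrr.
by rewrite !nth_default ?subr0// ?(sz id) ?sz.
Qed.

Lemma prod_fset_sub (K : comNzRingType) (T : choiceType) (A B : {fset T})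
    (F : T -> K) : {subset A <= B} ->
  \prod_(l <- B) F l = \prod_(l <- A) F l * \prod_(l <- B | l \notin A) F l.
Proof.
move=> AB; rewrite (bigID (fun l => l \in A)) /=; congr (_ * _).
rewrite -big_filter; apply: perm_big; apply: uniq_perm => [||l].
- by rewrite filter_uniq// fset_uniq.
- exact: fset_uniq.
by rewrite mem_filter; case: (boolP (l \in A)) => // /AB.
Qed.

Section Lattice.
Variables (R : realType) (C : fieldType) (v : C -> R).
Hypothesis hv : nonarch_abs v.
Hypothesis v_complete : forall u : nat -> C, vcauchy v u -> exists l, vcvg v u l.
Variable L : set C.
Hypothesis L0 : L 0.
Hypothesis LB : forall x y, L x -> L y -> L (x - y).
Hypothesis Lfin : forall r : R, finite_set (L `&` [set x | v x <= r]).
Implicit Types (x y z h : C) (k m n : nat).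

Let v_ge0 := nabs_ge0 hv.
Let vM := nabsM hv.

Definition lball k : {fset C} := fset_set (L `&` [set x | v x <= k%:R]).

Definition lball0 k : {fset C} := (lball k `\ 0)%fset.

Lemma in_lball k x : reflect (L x /\ v x <= k%:R) (x \in lball k).
Proof. by rewrite in_fset_set//; apply: (iffP idP); rewrite inE. Qed.

Lemma in_lball0 k x : reflect [/\ x != 0, L x & v x <= k%:R] (x \in lball0 k).
Proof.
rewrite in_fsetD1; apply: (iffP andP) => [[x0 /in_lball[]]|[x0 Lx vx]] //.
by split=> //; apply/in_lball.
Qed.

Lemma lball0_mono k m : (k <= m)%N -> {subset lball0 k <= lball0 m}.
Proof.
move=> km x /in_lball0[x0 Lx vx]; apply/in_lball0; split=> //.
by rewrite (le_trans vx)// ler_nat.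
Qed.

Lemma lball0_sub k : [set` lball0 k] `<=` L `\ 0.
Proof. by move=> x /= /in_lball0[x0 Lx _]; split=> //; apply/eqP. Qed.

Definition lprod (S : {fset C}) z : C := \prod_(l <- S) (1 - z / l).

Definition epoly k : {poly C} := 'X * \prod_(l <- lball0 k) (1 - l^-1 *: 'X).

Lemma horner_epoly k z : (epoly k).[z] = z * lprod (lball0 k) z.
Proof.
rewrite /epoly hornerM hornerX horner_prod; congr (_ * _).
by apply: eq_bigr => l _; rewrite !hornerE mulrC.
Qed.

Lemma epoly_additive k x y : (epoly k).[x + y] = (epoly k).[x] + (epoly k).[y].
Proof.
(* From 1 - z/l = (-1/l) (z - l); the root 0 of the full product supplies the factor z of
   [epoly]. *)
pose c := \prod_(l <- lball0 k) - l^-1.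
have b0 : 0 \in lball k by apply/in_lball; rewrite (nabs0 hv) ler0n.
suff E z : (epoly k).[z] = c * (\prod_(l <- lball k) ('X - l%:P)).[z].
  rewrite !E subgroup_poly_additive ?mulrDr// => {x y} x y.
  move=> /in_lball[Lx vx] /in_lball[Ly vy]; apply/in_lball; split; first exact: LB.
  by apply: (nabsD_le hv); rewrite ?(nabsN hv).
rewrite horner_epoly horner_prod (big_fsetD1 0)//= hornerXsubC subr0 mulrCA.
congr (_ * _); rewrite /lprod /c -big_split /= big_seq [RHS]big_seq.
apply: eq_bigr => l /in_lball0[l0 _ _]; rewrite hornerXsubC mulrBr.
by rewrite !mulNr mulVf// opprK addrC mulrC.
Qed.

Section ValueConvergence.
Variable z : C.

(** For d <= 1 the ball of radius d around 1 is closed under products, so the estimate for a single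
    factor holds for any number of them. *)
Lemma lprod_sub1 (P : pred C) (S : {fset C}) k : (0 < k)%N -> v z <= k%:R ->
    (forall l, l \in S -> P l -> k%:R < v l) ->
  v (\prod_(l <- S | P l) (1 - z / l) - 1) <= v z / k%:R.
Proof.
move=> k0 zk HS; have k0' : 0 < k%:R :> R by rewrite ltr0n.
have zk1 : v z / k%:R <= 1 by rewrite ler_pdivrMr// mul1r.
have zk0 : 0 <= v z / k%:R by rewrite divr_ge0// ltW.
rewrite big_seq_cond.
apply: (big_ind (fun x => v (x - 1) <= v z / k%:R)).
- by rewrite subrr (nabs0 hv).
- move=> x y xk yk; have -> : x * y - 1 = x * (y - 1) + (x - 1).
    by rewrite mulrBr mulr1 addrA subrK.
  apply: (nabsD_le hv) => //; rewrite vM -[leRHS]mul1r ler_pM//.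
  by rewrite -[x](subrK 1); apply: (nabsD_le hv); rewrite ?(nabs1 hv)// (le_trans xk).
move=> l /andP[lS Pl]; have kl := HS l lS Pl.
rewrite addrAC subrr add0r (nabsN hv) vM (nabsV hv) ler_wpM2l//.
by rewrite lef_pV2 ?posrE// ?(lt_trans k0')// ltW.
Qed.

Lemma lprod_nabs1 (P : pred C) (S : {fset C}) :
    (forall l, l \in S -> P l -> v z < v l) ->
  v (\prod_(l <- S | P l) (1 - z / l)) = 1.
Proof.
move=> HS; rewrite big_seq_cond; apply: (big_ind (fun x => v x = 1)).
- exact: nabs1.
- by move=> x y x1 y1; rewrite vM x1 y1 mulr1.
move=> l /andP[lS Pl]; have zl := HS l lS Pl.
rewrite -(nabs1 hv); apply: (nabs_isosceles hv).
rewrite addrAC subrr add0r (nabsN hv) vM (nabsV hv) (nabs1 hv).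
by rewrite ltr_pdivrMr ?mul1r// (le_lt_trans _ zl).
Qed.

Lemma far_from_lball0 k (S : {fset C}) : [set` S] `<=` L `\ 0 ->
  forall l, l \in S -> l \notin lball0 k -> k%:R < v l.
Proof.
move=> SL l /SL /= [Ll /eqP l0] lk; rewrite ltNge; apply: contra lk => lk.
exact/in_lball0.
Qed.

(** Factors with |l| > |z| have absolute value 1, so the absolute value of the products stabilises;
    being also close to 1, these factors change the product little. The stable value is recorded
    because it keeps the limit away from 0 off [L]. *)
Lemma lprod_net (e : R) : 0 < e -> exists2 N, v z < N%:R &
  forall m (S : {fset C}), (N <= m)%N ->
    {subset lball0 m <= S} -> [set` S] `<=` L `\ 0 ->
    v (lprod S z) = v (lprod (lball0 N) z) /\
    v (lprod S z - lprod (lball0 m) z) < e.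
Proof.
move=> e0; have archi (x : R) : 0 <= x -> exists k, x < k%:R.
  move=> x0; exists (Num.truncn x).+1; exact: truncnS_gt.
have [k0 zk0] := archi _ (v_ge0 z).
have nE N m (S : {fset C}) : (k0 <= N)%N -> (N <= m)%N ->
    {subset lball0 m <= S} -> [set` S] `<=` L `\ 0 ->
    v (lprod S z) = v (lprod (lball0 N) z).
  move=> k0N Nm mS SL; rewrite /lprod (@prod_fset_sub _ _ (lball0 N) S).
    rewrite vM [X in _ * X]lprod_nabs1 ?mulr1// => l lS lN.
    apply: lt_trans (far_from_lball0 SL lS lN).
    by rewrite (lt_le_trans zk0)// ler_nat.
  by move=> l /(lball0_mono Nm)/mS.
(* Beyond the ball of radius m the product moves by at most its stable absolute value times |z| / m,
   which is below [e] as soon as m > M. *)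
pose M := v (lprod (lball0 k0) z) * v z / e.
have [k1 Mk1] := archi M (divr_ge0 (mulr_ge0 (v_ge0 _) (v_ge0 _)) (ltW e0)).
pose N := maxn k0 k1.+1; exists N.
  by rewrite (lt_le_trans zk0)// ler_nat leq_maxl.
move=> m S Nm mS SL; split; first exact: (nE N m S (leq_maxl _ _)).
have k0m : (k0 <= m)%N by rewrite (leq_trans (leq_maxl _ _) Nm).
have k1m : (k1 < m)%N by rewrite (leq_trans (leq_maxr _ _) Nm).
have m0 : 0 < m%:R :> R by rewrite ltr0n (leq_ltn_trans _ k1m).
rewrite /lprod (@prod_fset_sub _ _ (lball0 m) S)// -[X in _ - X]mulr1 -mulrBr vM.
rewrite -/(lprod _ z) (nE k0 m)//; last exact: lball0_sub.
apply: (@le_lt_trans _ _ (v (lprod (lball0 k0) z) * (v z / m%:R))).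
  rewrite ler_wpM2l// lprod_sub1// ?(leq_ltn_trans _ k1m)//.
    by rewrite ltW// (lt_le_trans zk0)// ler_nat.
  exact: far_from_lball0.
rewrite mulrA ltr_pdivrMr// -ltr_pdivrMl// mulrC.
by rewrite (lt_trans Mk1)// ltr_nat.
Qed.

(** The limit along balls is the limit of the net: every finite set containing a large ball has its
    product close to that of the ball. *)
Lemma e_is_prod : exists2 P, is_prod v (L `\ 0) (fun l => 1 - z / l) P &
  vcvg v (fun k => lprod (lball0 k) z) P.
Proof.
have [P HP] : exists P, vcvg v (fun k => lprod (lball0 k) z) P.
  apply: v_complete => e e0; have [N _ HN] := lprod_net e0.
  have H m n : (N <= n)%N -> (n <= m)%N ->
      v (lprod (lball0 m) z - lprod (lball0 n) z) < e.
    move=> Nn nm; have [] // := HN n (lball0 m) Nn (lball0_mono nm).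
    exact: lball0_sub.
  exists N => m n Nm Nn; have [|/ltnW] := leqP n m; first exact: H.
  by rewrite (nabsBC hv); exact: H.
exists P => // e e0; have [N _ HN] := lprod_net e0.
have /(vcvgP hv)/(_ e e0)[N' HN'] := HP.
exists (lball0 (maxn N N')); first exact: lball0_sub.
move=> S mS SL; apply: (nabs_dist_lt hv) (HN' _ (leq_maxr N N')).
by have [] := HN _ S (leq_maxl N N') (fun x => mS x) SL.
Qed.

Lemma is_prod_unique (A : set C) (f : C -> C) P Q :
  is_prod v A f P -> is_prod v A f Q -> P = Q.
Proof.
move=> HP HQ; apply/eqP; rewrite -subr_eq0; apply/negPn/negP => /(nabs_gt0 hv) d0.
have [S SA HS] := HP _ d0; have [T TA HT] := HQ _ d0.
have UA : [set` (S `|` T)%fset] `<=` A.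
  by move=> x /=; rewrite in_fsetU => /orP[/SA|/TA].
have: v (P - Q) < v (P - Q); last by rewrite ltxx.
apply: (nabs_dist_lt hv (y := \prod_(l <- (S `|` T)%fset) f l)).
  by rewrite (nabsBC hv); apply: HS UA => x /= xS; rewrite in_fsetU xS.
by apply: HT UA => x /= xT; rewrite in_fsetU xT orbT.
Qed.

Lemma e_cvg : vcvg v (fun k => (epoly k).[z]) (e_ v L z).
Proof.
have [P HP cP] := e_is_prod.
rewrite /e_ (xget_unique _ HP); last by move=> Q HQ; exact: is_prod_unique HP.
apply: eq_vcvg (vcvgZ hv z cP) => k; by rewrite horner_epoly.
Qed.

(** No factor vanishes off [L], and the limit inherits the absolute value at which the partial
    products stabilise. *)
Lemma e_neq0 : ~ L z -> e_ v L z != 0.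
Proof.
move=> nLz; have z0 : z != 0 by apply: contra_notN nLz => /eqP->.
have [P HP cP] := e_is_prod.
rewrite /e_ (xget_unique _ HP); last by move=> Q HQ; exact: is_prod_unique HP.
rewrite mulf_neq0//.
have [N _ HN] := lprod_net ltr01.
have pN0 : 0 < v (lprod (lball0 N) z).
  apply: (nabs_gt0 hv); rewrite /lprod big_seq; apply: (big_ind (fun x => x != 0)).
  - exact: oner_neq0.
  - by move=> x y; exact: mulf_neq0.
  move=> l /in_lball0[l0 Ll _]; rewrite subr_eq0; apply: contra_notN nLz => /eqP E.
  by rewrite -[z](divfK l0) -E mul1r.
have /(vcvgP hv)/(_ _ pN0)[N' HN'] := cP.
have [E _] := HN _ _ (leq_maxl N N') (fun _ => id) (@lball0_sub _).
have := HN' _ (leq_maxr N N'); rewrite (nabsBC hv) -E => /(nabs_isosceles hv).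
by move=> PE; apply: contraTneq pN0 => P0; rewrite -E -PE P0 (nabs0 hv) ltxx.
Qed.

End ValueConvergence.

Lemma e_additive x y : e_ v L (x + y) = e_ v L x + e_ v L y.
Proof.
apply: (vcvg_unique hv (e_cvg (x + y))).
apply: eq_vcvg (vcvgD hv (e_cvg x) (e_cvg y)) => k.
by rewrite epoly_additive.
Qed.

Lemma nabs_inv_bound : exists2 rho : R, 1 <= rho &
  forall l, L l -> l != 0 -> (v l)^-1 <= rho.
Proof.
(* The sum is a crude maximum over the finitely many nonzero elements with |l| <= 1; the summand 1
   takes care of all the others. *)
exists (1 + \sum_(l <- lball0 1) (v l)^-1).
  by rewrite lerDl sumr_ge0// => l _; rewrite invr_ge0.
move=> l Ll l0; have s0 (s : seq C) : 0 <= \sum_(x <- s) (v x)^-1.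
  by rewrite sumr_ge0// => x _; rewrite invr_ge0.
have [l1|l1] := leP (v l) 1.
  rewrite (big_fsetD1 l) /=; last by apply/in_lball0.
  by rewrite addrCA lerDl addr_ge0.
apply: (@le_trans _ _ 1); last by rewrite lerDl.
by rewrite invf_le1 ?(lt_trans ltr01)// ltW.
Qed.

Lemma pow_bounded_lprod (rho : R) (P : pred C) (S : {fset C}) : 0 <= rho ->
    (forall l, l \in S -> P l -> (v l)^-1 <= rho) ->
  pow_bounded v rho (nth 0 (\prod_(l <- S | P l) (1 - l^-1 *: 'X))).
Proof.
move=> rho0 HS; rewrite big_seq_cond.
apply: (big_ind (fun p : {poly C} => pow_bounded v rho (nth 0 p))).
- exact: (pow_bounded1 hv).
- by move=> p q; exact: (pow_boundedM hv).
move=> l /andP[lS Pl] [|[|j]]; rewrite coefB coef1 coefZ coefX /=.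
- by rewrite mulr0 subr0 (nabs1 hv).
- by rewrite mulr1 sub0r (nabsN hv) (nabsV hv) expr1 HS.
- by rewrite mulr0 subr0 (nabs0 hv) exprn_ge0.
Qed.

Section Coefficients.
Variable rho : R.
Hypothesis rho1 : 1 <= rho.
Hypothesis Lrho : forall l, L l -> l != 0 -> (v l)^-1 <= rho.

Let rho0 : 0 <= rho. Proof. exact: le_trans rho1. Qed.

Lemma pow_bounded_epoly k : pow_bounded v rho (nth 0 (epoly k)).
Proof.
apply: (pow_boundedM hv) => //.
  move=> [|[|j]]; rewrite coefX /= ?(nabs0 hv) ?(nabs1 hv) ?expr0 ?expr1//.
  exact: exprn_ge0.
by apply: pow_bounded_lprod => // l /in_lball0[l0 Ll _] _; exact: Lrho.
Qed.

(** The quotient of the two polynomials has constant term 1 and only roots of absolute value > k, so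
    its other coefficients are at most 1/k. *)
Lemma epoly_coef_dist k m j : (0 < k)%N -> (k <= m)%N ->
  v ((epoly m)`_j - (epoly k)`_j) <= rho ^+ j / k%:R.
Proof.
move=> k0 km; have k0' : 0 < k%:R :> R by rewrite ltr0n.
pose Q : {poly C} := \prod_(l <- lball0 m | l \notin lball0 k) (1 - l^-1 *: 'X).
have QE : epoly m = epoly k * Q.
  by rewrite /epoly -mulrA -prod_fset_sub//; exact: lball0_mono.
have Q0 : Q`_0 = 1.
  rewrite -horner_coef0 horner_prod big1// => l _.
  by rewrite hornerD hornerN hornerZ hornerX hornerC mulr0 subr0.
have Qb : pow_bounded v k%:R^-1 (nth 0 Q).
  apply: pow_bounded_lprod; first by rewrite invr_ge0 ltW.
  move=> l lm lk; have kl := far_from_lball0 (@lball0_sub m) lm lk.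
  by rewrite lef_pV2 ?posrE// ?(lt_trans k0')// ltW.
have -> : (epoly m)`_j - (epoly k)`_j = (epoly k * (Q - 1))`_j.
  by rewrite QE mulrBr mulr1 coefB.
rewrite coefM; have kV0 : 0 <= k%:R^-1 :> R by rewrite invr_ge0 ltW.
apply: (nabs_sum_le hv) => [|i _]; first by rewrite mulr_ge0// exprn_ge0.
have ij : (i <= j)%N by rewrite -ltnS.
have -> : rho ^+ j = rho ^+ i * rho ^+ (j - i) by rewrite -exprD subnKC.
rewrite vM -mulrA ler_pM//; first exact: pow_bounded_epoly.
case: (j - i)%N => [|s]; rewrite coefB coef1 /=.
  by rewrite Q0 subrr (nabs0 hv) mulr_ge0.
rewrite subr0; apply: le_trans (Qb _) _; rewrite exprS mulrC ler_wpM2r//.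
apply: (@le_trans _ _ 1); last exact: exprn_ege1.
by rewrite exprn_ile1// invf_le1// ler1n.
Qed.

Lemma vcvg_dist_le (u : nat -> C) l x (e : R) N : vcvg v u l ->
  (forall n, (N <= n)%N -> v (u n - x) <= e) -> v (l - x) <= e.
Proof.
move=> /(vcvgP hv) ul ux; rewrite leNgt; apply/negP => elx.
have [N' HN'] := ul _ (le_lt_trans (le_trans (v_ge0 _) (ux N (leqnn N))) elx).
have := ux _ (leq_maxl N N') => /le_lt_trans/(_ elx) H.
have := nabs_dist_lt hv (x := l) (y := u (maxn N N')) (z := x) (e := v (l - x)).
by rewrite ltxx (nabsBC hv) => /(_ (HN' _ (leq_maxr N N')) H).
Qed.

Lemma archi_inv (e : R) : 0 < e -> exists2 N, (0 < N)%N &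
  forall n, (N <= n)%N -> n%:R^-1 < e.
Proof.
move=> e0; have e0' : 0 < e^-1 by rewrite invr_gt0.
exists (Num.truncn e^-1).+1 => // n nN.
have n0 : 0 < n%:R :> R by rewrite ltr0n (leq_trans _ nN).
rewrite -[e]invrK ltf_pV2 ?posrE//.
by apply: lt_le_trans (truncnS_gt _) _; rewrite ler_nat.
Qed.

Lemma epoly_coef_cvg j : exists a, vcvg v (fun k => (epoly k)`_j) a.
Proof.
apply: v_complete => e e0.
have rj : 0 < rho ^+ j by rewrite exprn_gt0// (lt_le_trans ltr01).
have [N N0 HN] := archi_inv (divr_gt0 e0 rj).
have H m n : (N <= n)%N -> (n <= m)%N -> v ((epoly m)`_j - (epoly n)`_j) < e.
  move=> Nn nm; apply: le_lt_trans (epoly_coef_dist _ (leq_trans N0 Nn) nm) _.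
  by rewrite mulrC -ltr_pdivlMr// HN.
exists N => m n Nm Nn; have [|/ltnW] := leqP n m; first exact: H.
by rewrite (nabsBC hv); exact: H.
Qed.

(** The coefficients are the limits of those of [epoly k]. The bound rho^j / k on the distance,
    weighted by |h|^j, is uniform in j for rho |h| < 1, which allows the two limits to be
    exchanged. *)
Lemma e_series : exists alpha : nat -> C,
  [/\ alpha 0%N = 0, pow_bounded v rho alpha,
      (forall p : {poly C}, (forall x, p.[x] = 0) -> p = 0) ->
        forall m r, (0 < m)%N -> (0 < r)%N -> alpha (r + m)%N *+ 'C(r + m, r) = 0
    & forall h, rho * v h < 1 -> vcvg v (psum alpha h) (e_ v L h)].
Proof.
have [alpha Ha] := choice epoly_coef_cvg; exists alpha.
have a_dist k j : (0 < k)%N -> v (alpha j - (epoly k)`_j) <= rho ^+ j / k%:R.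
  move=> k0; apply: (vcvg_dist_le (N := k) (Ha j)) => n kn.
  exact: epoly_coef_dist.
split.
- apply: (vcvg_unique hv (Ha 0%N)); apply: eq_vcvg (vcvg_cst hv 0) => k.
  by rewrite /epoly coefXM.
- move=> j; rewrite -[alpha j]subr0; apply: (vcvg_dist_le (N := 0%N) (Ha j)) => n _.
  by rewrite subr0; exact: pow_bounded_epoly.
- move=> inj m r m0 r0; rewrite -mulr_natl.
  apply: (vcvg_unique hv (vcvgZ hv _ (Ha (r + m)%N))).
  apply: eq_vcvg (vcvg_cst hv 0) => k; rewrite mulr_natl.
  by rewrite (additive_poly_coef inj)// => x y; exact: epoly_additive.
move=> h rh; apply/(vcvgP hv) => e e0.
have [N HN] := exprn_small (mulr_ge0 rho0 (v_ge0 h)) rh e0.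
(* Three comparisons through one [epoly k] with k large: truncated series with truncated polynomial
   (at most 1/k), truncated with full polynomial (a tail bound uniform in k), and polynomial with e
   at h. *)
exists N => n Nn.
have [K K0 HK] := archi_inv e0.
have /(vcvgP hv)/(_ e e0)[K' HK'] := e_cvg h.
pose k := maxn K K'; have k0 : (0 < k)%N by rewrite leq_max K0.
apply: (nabs_dist_lt hv) (HK' k (leq_maxr K K')).
apply: (nabs_dist_lt hv (y := psum (nth 0 (epoly k)) h n)).
  rewrite /psum -sumrB; apply: le_lt_trans (HK k (leq_maxl K K')).
  apply: (nabs_sum_le hv) => [|j _]; first by rewrite invr_ge0.
  rewrite -mulrBl vM (nabsX hv).
  apply: (@le_trans _ _ (rho ^+ j / k%:R * v h ^+ j)).
    by rewrite ler_wpM2r ?exprn_ge0// a_dist.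
  rewrite mulrAC -exprMn ler_piMl ?invr_ge0//.
  by rewrite exprn_ile1 ?mulr_ge0// ltW.
rewrite (nabsBC hv); pose s := maxn n (size (epoly k)).
have -> : (epoly k).[h] = psum (nth 0 (epoly k)) h s.
  by rewrite (horner_coef_wide _ (leq_maxr n _)).
apply: le_lt_trans (HN _ Nn); apply: (psum_tail hv) => //.
  exact: pow_bounded_epoly.
exact: leq_maxl.
Qed.

End Coefficients.

End Lattice.

(** * Discrete vector spaces over F as discrete subgroups *)

Section FspaceSubgroup.
Variables (R : realType) (F : finFieldType) (C : fieldType).
Variables (iota : {rmorphism F -> C}) (v : C -> R).

Lemma findim_Fspace0 (V : set C) : findim_Fspace iota V -> V 0.
Proof.
move=> [n [b ->]]; exists [ffun=> 0] => //.
by apply: big1 => i _; rewrite ffunE rmorph0 mul0r.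
Qed.

Lemma findim_FspaceB (V : set C) : findim_Fspace iota V ->
  forall x y, V x -> V y -> V (x - y).
Proof.
move=> [n [b ->]] _ _ [a1 _ <-] [a2 _ <-]; exists [ffun i => a1 i - a2 i] => //.
by rewrite -sumrB; apply: eq_bigr => i _; rewrite ffunE rmorphB mulrBl.
Qed.

Lemma findim_Fspace_finite (V : set C) : findim_Fspace iota V -> finite_set V.
Proof. by move=> [n [b ->]]; apply: finite_image; exact: finite_finset. Qed.

Lemma discrete_Fspace_subgroup (L : set C) : discrete_Fspace iota v L ->
  [/\ L 0, forall x y, L x -> L y -> L (x - y) &
      forall r : R, finite_set (L `&` [set x | v x <= r])].
Proof.
case=> [Lf|[[V [Vf VS ->]] Lfin]].
  split; [exact: findim_Fspace0|exact: findim_FspaceB|].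
  by move=> r; apply: finite_setIl; exact: findim_Fspace_finite.
split; first by exists 0%N => //; exact: findim_Fspace0.
- have mono : forall n m, (n <= m)%N -> V n `<=` V m.
    move=> n m /subnK <-; elim: (m - n)%N => [|k IH] // x /IH; exact: VS.
  move=> x y [n _ Vx] [m _ Vy]; exists (maxn n m) => //.
  apply: findim_FspaceB => //; [exact: mono (leq_maxl n m) _ Vx|].
  exact: mono (leq_maxr n m) _ Vy.
move=> r; apply: sub_finite_set (Lfin 0 r) => x [Lx vx].
by split=> //; rewrite /= subr0.
Qed.

End FspaceSubgroup.

(** * Consequences of |theta| > 1: arbitrarily small elements and infinitely many points *)

Section NontrivialAbs.
Variables (R : realType) (C : fieldType) (v : C -> R) (theta : C).
Hypotheses (hv : nonarch_abs v) (theta1 : 1 < v theta).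

Let theta_gt0 : 0 < v theta. Proof. exact: lt_trans theta1. Qed.

Lemma nabs_small (d : R) : 0 < d -> exists2 h, h != 0 & v h < d.
Proof.
have thV1 : (v theta)^-1 < 1 by rewrite invf_lt1.
have thV0 : 0 <= (v theta)^-1 by rewrite invr_ge0 ltW.
move=> /(exprn_small thV0 thV1)[N HN]; exists (theta^-1 ^+ N).
  rewrite expf_neq0// invr_neq0//; apply: contraTneq theta_gt0 => ->.
  by rewrite (nabs0 hv) ltxx.
by rewrite (nabsX hv) (nabsV hv) HN.
Qed.

(** The powers of [theta] have distinct absolute values, which gives too many roots. This discharges
    the hypothesis [eval_inj] of the formal part. *)
Lemma nabs_eval_inj (p : {poly C}) : (forall x, p.[x] = 0) -> p = 0.
Proof.
move=> p0; apply/eqP/negPn/negP => pn0.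
pose rs := mkseq (fun i => theta ^+ i) (size p).
have urs : uniq rs.
  apply: mkseq_uniq => i j /(congr1 v); rewrite !(nabsX hv).
  by apply: ieexprIn => //; rewrite gt_eqF.
have rrs : all (root p) rs by apply/allP => x _; apply/rootP.
by have := max_poly_roots pn0 rrs urs; rewrite size_mkseq ltnn.
Qed.

End NontrivialAbs.

(** * Taylor expansions of the powers of t *)

Section InverseExponential.
Variables (R : realType) (C : fieldType) (v : C -> R).
Hypothesis hv : nonarch_abs v.
Hypothesis v_complete : forall u : nat -> C, vcauchy v u -> exists l, vcvg v u l.
Variables (e : C -> C) (alpha : nat -> C) (rho : R).
Hypothesis e_add : forall x y, e (x + y) = e x + e y.
Hypothesis alpha0 : alpha 0%N = 0.
Hypothesis rho1 : 1 <= rho.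
Hypothesis alpha_rho : pow_bounded v rho alpha.
Hypothesis alpha_cvg : forall h, rho * v h < 1 -> vcvg v (psum alpha h) (e h).

Let rho0 : 0 <= rho. Proof. exact: le_trans rho1. Qed.
Let v_ge0 := nabs_ge0 hv.

Lemma series_taylor0 : is_taylor v e 0 alpha.
Proof.
exists rho^-1 => [|z]; first by rewrite invr_gt0 (lt_le_trans ltr01).
rewrite subr0 => zr; apply: alpha_cvg.
by rewrite -ltr_pdivlMl ?mulr1// (lt_le_trans ltr01).
Qed.

Lemma pow_bounded_spow j : pow_bounded v rho (fun r => spow alpha r j).
Proof.
(* The truncation order is freed from [r], so that the induction on [j] concerns the powers of one
   fixed polynomial. *)
move=> r; rewrite /spow; move: r.+1 => N; move: r.
have tb : pow_bounded v rho (nth 0 (trunc_series alpha N)).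
  move=> i; rewrite coef_poly; case: ifP => // _.
  by rewrite (nabs0 hv) exprn_ge0.
elim: j => [|j IH]; first by rewrite expr0; exact: (pow_bounded1 hv).
by rewrite exprS; exact: (pow_boundedM hv).
Qed.

Variable z : C.
Hypothesis ez0 : e z != 0.
Let t := (e z)^-1.
(** The coefficient of x^r in (t e(x))^k can be nonzero only for k <= r, and is then at most |t|^k
    rho^r <= sigma^r. *)
Let sigma := rho * Num.max 1 (v t).

Let max1 : 1 <= Num.max 1 (v t). Proof. by rewrite le_max lexx. Qed.
Let sigma1 : 1 <= sigma. Proof. by rewrite mulr_ege1. Qed.
Let sigma0 : 0 <= sigma. Proof. exact: le_trans sigma1. Qed.
Let rho_sigma : rho <= sigma.
Proof. by rewrite -[leLHS]mulr1 ler_wpM2l. Qed.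

Lemma pow_bounded_winv n : pow_bounded v sigma (winv alpha t n).
Proof.
move=> r; apply: (nabs_sum_le hv) => [|k _]; first exact: exprn_ge0.
rewrite !(nabsM hv) (nabsX hv) (nabsN hv) exprMn mulrC.
apply: ler_pM => //; [by rewrite mulr_ge0 ?exprn_ge0|exact: pow_bounded_spow|].
rewrite -[leRHS]mul1r; apply: ler_pM => //; [exact: exprn_ge0|exact: nabs_nat|].
apply: (@le_trans _ _ (Num.max 1 (v t) ^+ k)).
  apply: lerXn2r; rewrite ?nnegrE//; first exact: le_trans max1.
  by rewrite le_max lexx orbT.
by rewrite ler_weXn2l// -ltnS.
Qed.

Let g i := (i == 0%N)%:R + t * alpha i.

Lemma pow_bounded_den : pow_bounded v sigma g.
Proof.
case=> [|i]; rewrite /g /=.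
  by rewrite alpha0 mulr0 addr0 expr0 (nabs1 hv).
rewrite add0r (nabsM hv) mulrC exprMn ler_pM//.
apply: (@le_trans _ _ (Num.max 1 (v t))); first by rewrite le_max lexx orbT.
by rewrite ler_eXnr.
Qed.

(** The sums W_k of the series [winv] satisfy W_0 = 1 and (1 + t e(h)) W_(k+1) = W_k, hence W_k = (1
    + t e(h))^-k; no numerical binomial series is summed. *)
Lemma inv_exp_taylor n :
  is_taylor v (fun w => (e w)^-1 ^+ n) z (fun r => t ^+ n * winv alpha t n r).
Proof.
exists sigma^-1 => [|w]; first by rewrite invr_gt0 (lt_le_trans ltr01).
move=> zr; pose h := w - z; have sh : sigma * v h < 1.
  by rewrite -ltr_pdivlMl ?mulr1// (lt_le_trans ltr01).
have rh : rho * v h < 1.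
  by apply: le_lt_trans sh; rewrite ler_wpM2r.
have gcvg : vcvg v (psum g h) (1 + t * e h).
  have c1 : vcvg v (psum (fun i => (i == 0%N)%:R) h) 1.
    apply/(vcvgP hv) => eps eps0; exists 1%N => -[//|m] _.
    rewrite /psum big_ord_recl big1 ?expr0 ?mul1r ?addr0 ?subrr ?(nabs0 hv)// => i _.
    by rewrite /= mul0r.
  apply: eq_vcvg (vcvgD hv c1 (vcvgZ hv t (alpha_cvg rh))) => m.
  rewrite /psum mulr_sumr -big_split; apply: eq_bigr => i _ /=.
  by rewrite mulrDl mulrA.
have W_ k : exists l, vcvg v (psum (winv alpha t k) h) l.
  exact: (psum_cvg hv v_complete sigma0 (@pow_bounded_winv k) sh).
have [W HW] := choice W_.
have W0 : W 0%N = 1.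
  apply: (vcvg_unique hv (HW 0%N)); apply/(vcvgP hv) => eps eps0.
  exists 1%N => -[//|m] _; rewrite /psum big_ord_recl big1 => [|i _].
    by rewrite winv0// expr0 !mul1r addr0 subrr (nabs0 hv).
  by rewrite winv0// mul0r.
have WS k : (1 + t * e h) * W k.+1 = W k.
  apply: (vcvg_unique hv) (HW k).
  apply: (psum_mul hv sigma0 pow_bounded_den (@pow_bounded_winv k.+1) sh) => // r.
  by rewrite winvS.
(* The recursion itself shows that the denominator is invertible: (1 + t e(h)) W_1 = 1. *)
have d0 : 1 + t * e h != 0.
  apply/eqP => d0; move: (WS 0%N) (oner_neq0 C).
  by rewrite d0 mul0r W0 => ->; rewrite eqxx.
have WE k : W k = (1 + t * e h)^-1 ^+ k.
  elim: k => [|k IH]; first by rewrite expr0.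
  by apply: (mulfI d0); rewrite WS exprS mulVKf.
have -> : (e w)^-1 ^+ n = t ^+ n * W n.
  rewrite WE -exprMn -invfM; congr (_^-1 ^+ _).
  by rewrite mulrDr mulr1 mulrA divff// mul1r -e_add addrCA subrr addr0.
apply: eq_vcvg (vcvgZ hv _ (HW n)) => m; rewrite /psum mulr_sumr.
by apply: eq_bigr => i _; rewrite mulrA.
Qed.

End InverseExponential.

(** * Laurent polynomials *)

Section Laurent.
Variable C : fieldType.

Lemma binz0 m : binz m 0 = 1.
Proof. by rewrite /binz big_ord0 fact0. Qed.

Lemma binz_nat (n j : nat) : binz n%:Z j = 'C(n, j)%:Z.
Proof.
rewrite /binz.
have -> : \prod_(i < j) (n%:Z - i%:Z) = (n ^_ j)%:Z.
  have [jn|nj] := leqP j n.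
    rewrite ffact_prod (big_morph Posz PoszM (erefl _)).
    by apply: eq_bigr => i _; rewrite subzn// ltnW// (leq_trans (ltn_ord i)).
  rewrite ffact_small//; apply/eqP/prodf_eq0.
  by exists (Ordinal nj) => //=; rewrite subrr.
by rewrite -bin_ffact PoszM mulzK// eqz_nat -lt0n fact_gt0.
Qed.

Lemma laurent_eval_Xz (m : int) (j : nat) (x : C) :
  laurent_eval (laurent_hyper j (laurent_Xz C m)) x =
  (binz m j)%:~R * x ^ (m - j%:Z).
Proof.
rewrite /laurent_eval (fsbigE [:: m - j%:Z])//=.
  rewrite big_cons big_nil in_setT addr0 /laurent_hyper /laurent_Xz subrK eqxx.
  by rewrite mul1r.
move=> i _; rewrite inE => ij; rewrite /laurent_hyper /laurent_Xz.
by move: ij; rewrite eq_sym subr_eq eq_sym => /negbTE->; rewrite !mul0r.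
Qed.

Lemma laurent_eval_mulXz (N j : nat) (m : int) (p : {poly C}) (x : C) :
    (size p <= N)%N ->
  laurent_eval (laurent_hyper j (laurent_mulXz m (laurent_poly p))) x =
  \sum_(i < N) p`_i * (binz (i%:Z + m) j)%:~R * x ^ (i%:Z + m - j%:Z).
Proof.
move=> pN; rewrite /laurent_eval.
rewrite (fsbigE [seq i%:Z + m - j%:Z | i <- iota 0 N])//=.
- rewrite big_map -[X in iota _ X]subn0 -/(index_iota 0 N) big_mkord.
  apply: eq_big => [i|i _]; first by rewrite in_setT.
  by rewrite /laurent_hyper /laurent_mulXz subrK addrK.
- rewrite map_inj_uniq ?iota_uniq// => i i' /addIr/addIr[].
  done.
move=> i _ iN; rewrite /laurent_hyper /laurent_mulXz.
case E: (i + j%:Z - m) => [k|k]; rewrite /= ?mul0r//.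
rewrite nth_default ?mul0r// (leq_trans pN)// leqNgt; apply: contra iN => kN.
apply/mapP; exists k; first by rewrite mem_iota.
by rewrite -E subrK addrK.
Qed.

Lemma laurent_eval_goss_poly (alpha : nat -> C) (r j : nat) (m : int) (x : C) :
  laurent_eval
    (laurent_hyper j (laurent_mulXz m (laurent_poly (goss_poly alpha r.+1)))) x =
  \sum_(k < r.+1) spow alpha r k * (binz (k.+1%:Z + m) j)%:~R *
    x ^ (k.+1%:Z + m - j%:Z).
Proof.
rewrite (@laurent_eval_mulXz r.+2).
  rewrite big_ord_recl [X in X * _ * _]coef_sum big1 => [|i _].
    rewrite !mul0r add0r; apply: eq_bigr => k _.
    by rewrite /= /bump leq0n add1n coef_goss_poly// -ltnS.
  by rewrite coefZ coefXn mulr0.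
apply/leq_sizeP => i ir; rewrite coef_sum big1// => k _.
by rewrite coefZ coefXn gtn_eqF ?mulr0// (leq_trans _ ir)// ltnS.
Qed.

End Laurent.

Theorem theorem3p3 (R : realType) (F : finFieldType) (C : fieldType)
    (iota : {rmorphism F -> C}) (theta : C) (v : C -> R)
    (hC : is_Cinf iota theta v)
    (L : set C) (hL : discrete_Fspace iota v L)
    (beta : nat -> nat -> C)
    (hbeta : forall r : nat,
       goss v L r.+1 = \sum_(j < r.+1) beta r j *: 'X^(j.+1)) :
  forall r : nat,
  [/\ forall n : nat, (1 <= n)%N -> forall z : C, ~ L z ->
        hyperderiv v r (fun w => t_ v L w ^+ n) z =
        (-1) ^+ r * (t_ v L z ^+ n *
          laurent_eval
            (laurent_hyper n.-1
              (laurent_mulXz (n%:Z - 2%:Z) (laurent_poly (goss v L r.+1))))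
            (t_ v L z)),
      forall n : nat, forall z : C, ~ L z ->
        hyperderiv v r (fun w => t_ v L w ^+ n) z =
        (-1) ^+ r * \sum_(j < r.+1) beta r j * t_ v L z ^+ j.+1 *
          laurent_eval
            (laurent_hyper j (laurent_Xz C (n%:Z + j%:Z - 1))) (t_ v L z)
    & forall n : nat, (1 <= n)%N -> forall z : C, ~ L z ->
        'C(n + r - 1, r)%:R * (goss v L (n + r)).[t_ v L z] =
        \sum_(j < r.+1) beta r j * t_ v L z ^+ j.+1 *
          laurent_eval
            (laurent_hyper j
              (laurent_mulXz (j%:Z - 1) (laurent_poly (goss v L n))))
            (t_ v L z)].
Proof.
case: hC => hv theta1 _ _ v_complete.
have [L0 LB Lfin] := discrete_Fspace_subgroup hL.
have v_small := nabs_small hv theta1.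
have eval_inj := nabs_eval_inj hv theta1.
have [rho rho1 Lrho] := nabs_inv_bound hv Lfin.
have [alpha [alpha0 a_rho a_add a_cvg]] :=
  e_series hv v_complete L0 LB Lfin rho1 Lrho.
have {}a_add := a_add eval_inj.
have e_add := e_additive hv v_complete L0 LB Lfin.
have hyper_e j : hyperderiv v j (e_ v L) 0 = alpha j.
  exact: (hyperderivE hv v_small _ (series_taylor0 rho1 a_cvg)).
(* The explicit solution shows that [xget] does not return its default value; uniqueness then
   identifies the chosen solution at positive indices. *)
have gossE k : (0 < k)%N -> goss v L k = goss_poly alpha k.
  have : goss_generating v L (goss v L).
    apply: (@xgetPex _ (fun=> 0) [set G | goss_generating v L G]).
    exists (goss_poly alpha) => i; rewrite -(goss_poly_generating alpha0).
    by apply: eq_bigr => j _; rewrite hyper_e.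
  move=> HG; apply: (goss_poly_unique alpha0) => i; rewrite -HG.
  by apply: eq_bigr => j _; rewrite hyper_e.
have betaE r j : (j <= r)%N -> beta r j = spow alpha r j.
  move=> jr; rewrite -coef_goss_poly// -gossE// hbeta coef_sum.
  have jr' : (j < r.+1)%N by [].
  rewrite (bigD1 (Ordinal jr'))//= coefZ coefXn eqxx mulr1 big1 ?addr0// => i ij.
  by rewrite coefZ coefXn eqSS eq_sym -val_eqE/= in ij *; rewrite (negbTE ij) mulr0.
move=> r.
(* The common form of the first two identities. The sign (-1)^k of binom(-n, k) becomes (-1)^r by
   [spow_odd] and leaves the sum. *)
have hyper n z : ~ L z -> hyperderiv v r (fun w => t_ v L w ^+ n) z =
    (-1) ^+ r * \sum_(k < r.+1)
      'C(n + k - 1, k)%:R * spow alpha r k * t_ v L z ^+ (n + k).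
  move=> Lz; have ez0 := e_neq0 hv v_complete L0 Lfin Lz.
  have tay := inv_exp_taylor hv v_complete e_add alpha0 rho1 a_rho a_cvg ez0 n.
  rewrite (hyperderivE hv v_small r tay) /winv !mulr_sumr; apply: eq_bigr => k _.
  rewrite -/(t_ v L z) (exprNn (t_ v L z)) exprD.
  set t := t_ v L z; set B := 'C(_, _)%:R.
  have -> : t ^+ n * (B * ((-1) ^+ k * t ^+ k) * spow alpha r k) =
      B * t ^+ n * t ^+ k * ((-1) ^+ k * spow alpha r k) by ring.
  by rewrite -spow_odd//; ring.
split.
- case=> // n _ z Lz; rewrite hyper//; congr (_ * _).
  rewrite gossE// laurent_eval_goss_poly mulr_sumr; apply: eq_bigr => k _ /=.
  have -> : k.+1%:Z + (n.+1%:Z - 2%:Z) = (k + n)%N%:Z by lia.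
  have -> : (k + n)%N%:Z - n%:Z = k%:Z by lia.
  have -> : 'C(n.+1 + k - 1, k) = 'C(k + n, n).
    by rewrite addSn subn1 /= addnC -bin_sub ?leq_addr// addKn.
  by rewrite binz_nat -pmulrn -exprnP exprD; ring.
- move=> n z Lz; rewrite hyper//; congr (_ * _); apply: eq_bigr => k _.
  have t0 : t_ v L z != 0 by rewrite invr_neq0// e_neq0.
  have kr : (k <= r)%N by rewrite -ltnS.
  rewrite betaE// laurent_eval_Xz.
  have -> : binz (n%:Z + k%:Z - 1) k = 'C(n + k - 1, k)%:Z.
    (* For n = k = 0 the upper index is -1 on the left but truncated to 0 on the right; both
       binomials are then 1. For k > 0 the index is a natural number. *)
    case: (nat_of_ord k) => [|j]; first by rewrite binz0 bin0.
    by rewrite -binz_nat; congr binz; lia.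
  (* The exponent n - 1 is negative for n = 0, hence the use of t <> 0. *)
  have -> : t_ v L z ^+ (n + k) = t_ v L z ^+ k.+1 * t_ v L z ^ (n%:Z - 1).
    by rewrite !exprnP -expfzDr//; congr (_ ^ _); lia.
  have -> : n%:Z + k%:Z - 1 - k%:Z = n%:Z - 1 by lia.
  by rewrite -pmulrn; ring.
case=> // m _ z Lz.
(* With n = m + 1 the left side becomes a double sum whose inner sums are the expansions of the
   right-hand terms, since t^(j-1) G_n has the exponents i + j. *)
rewrite gossE// !addSn subn1 /= addnC goss_poly_binom//.
apply: eq_bigr => j _; have jr : (j <= r)%N by rewrite -ltnS.
rewrite betaE// gossE// laurent_eval_goss_poly mulr_sumr; apply: eq_bigr => i _.
have -> : i.+1%:Z + (j%:Z - 1) = (i + j)%N%:Z by lia.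
have -> : (i + j)%N%:Z - j%:Z = i%:Z by lia.
by rewrite binz_nat -pmulrn -exprnP -addnS exprD; ring.
Qed.
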